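(* Let $N\ge2$, $x_1>x_2>\cdots>x_N$ be real, $\rho=\sum_{j=1}^N\rho_j\delta_{x_j}$ with $\rho_j>0$, $\sum\rho_j=1$, and $\rho_t=e^{2tx}d\rho(x)/\int e^{2tx}d\rho(x)$. Let $a_n(t)>0$ ($1\le n\le N-1$) and $b_n(t)$ ($1\le n\le N$) be the Jacobi parameters of $\rho_t$, defined by $xP_n(x)=P_{n+1}(x)+b_{n+1}P_n(x)+a_n^2P_{n-1}(x)$ for the monic orthogonal polynomials $P_n=P_n(\cdot;\rho_t)$ ($P_{-1}=0$, $P_0=1$). Then there are constants $C_3,C_4$ such that for all $t\ge0$, \[ |b_j(t)-x_j|\le C_3\bigl[e^{2t(x_{j+1}-x_j)}+e^{2t(x_j-x_{j-1})}\bigr]\quad(1\le j\le N), \] \[ |a_j(t)|\le C_4\bigl[e^{t(x_{j+2}-x_{j+1})}+e^{t(x_{j+1}-x_j)}+e^{t(x_j-x_{j-1})}\bigr]\quad(1\le j\le N-1), \] where any term involving $x_0$ or $x_{N+1}$ is omitted. *)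

(* Defs.v *)
From HB Require Import structures.
From mathcomp Require Import all_boot all_order all_algebra.
From mathcomp Require Import all_classical all_reals.
From mathcomp Require Import sequences exp.
Set Implicit Arguments. Unset Strict Implicit. Unset Printing Implicit Defensive.
Import Order.TTheory GRing.Theory Num.Theory.
Local Open Scope ring_scope.

(* Points x_1 > ... > x_N and weights rho_1..rho_N are indexed 1..N (nat). *)

Definition tilt_weight (R : realType) (N : nat) (x rho : nat -> R) (t : R)
  (j : nat) : R :=
  rho j * expR (2 * t * x j) / \sum_(1 <= k < N.+1) rho k * expR (2 * t * x k).

Definition tilt_ip (R : realType) (N : nat) (x rho : nat -> R) (t : R)
  (p q : {poly R}) : R :=
  \sum_(1 <= j < N.+1) tilt_weight N x rho t j * p.[x j] * q.[x j].

Definition monic_OPs (R : realType) (N : nat) (x rho : nat -> R) (t : R)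
  (P : nat -> {poly R}) : Prop :=
  forall n, (n <= N)%N ->
    [/\ P n \is monic, size (P n) = n.+1 &
        forall q : {poly R}, (size q <= n)%N -> tilt_ip N x rho t (P n) q = 0].

Definition prevP (R : realType) (P : nat -> {poly R}) (n : nat) : {poly R} :=
  if n is k.+1 then P k else 0.

Definition jacobi_params (R : realType) (N : nat) (x rho : nat -> R) (t : R)
  (a b : nat -> R) : Prop :=
  (forall n, (1 <= n <= N.-1)%N -> 0 < a n) /\
  exists P : nat -> {poly R}, monic_OPs N x rho t P /\
    forall n, (n < N)%N ->
      'X * P n = P n.+1 + b n.+1 *: P n + (a n ^+ 2) *: prevP P n.

(* Main.v *)
(** For t >= 0 the tilted weights w_1, ..., w_N decrease up to a constant factor,
    so the monic orthogonal polynomial P_n is close to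
    Q_n = (X - x_1) ... (X - x_n).  Comparing with Q_n in the extremal problem
    gives |P_n|^2 <= C w_{n+1}, and Lagrange interpolation at x_1, ..., x_n gives
    the reverse bound w_{n+1} <= C |P_n|^2, both uniformly in t.  Hence
    a_n^2 = |P_n|^2 / |P_{n-1}|^2 is of order w_{n+1} / w_n.
    For b_{n+1} - x_{n+1} = sum_j w_j (x_j - x_{n+1}) P_n(x_j)^2 / |P_n|^2, the
    terms j > n+1 are of order w_{n+2} / w_{n+1} because P_n is bounded on the
    nodes; for j <= n, orthogonality of P_n to the j-th Lagrange polynomial gives
    w_j |P_n(x_j)| <= C w_{n+1}, so these terms are of order w_{n+1} / w_n. *)

Require Import Defs.
From HB Require Import structures.
From mathcomp Require Import all_boot all_order all_algebra.
From mathcomp Require Import all_classical all_reals.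
From mathcomp Require Import sequences exp.
From mathcomp Require Import zify ring.
Import Order.TTheory GRing.Theory Num.Theory.
Local Open Scope ring_scope.

(** * Elementary bounds for finite sums and finite families *)

Lemma sum_le_const (R : realType) (n : nat) (F : nat -> R) (c : R) :
  (forall j, (1 <= j <= n)%N -> F j <= c) ->
  \sum_(1 <= j < n.+1) F j <= n%:R * c.
Proof.
move=> hF; apply: (@le_trans _ _ (\sum_(1 <= j < n.+1) c)).
  by apply: ler_sum_nat => j hj; apply: hF; lia.
by rewrite sumr_const_nat subn1 /= mulr_natl.
Qed.

Lemma term_le_sum (R : realType) (n : nat) (F : nat -> R) (j : nat) :
  (forall i, (1 <= i <= n)%N -> 0 <= F i) -> (1 <= j <= n)%N ->
  F j <= \sum_(1 <= i < n.+1) F i.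
Proof.
move=> hF hj; have hj' : j \in index_iota 1 n.+1 by rewrite mem_index_iota; lia.
rewrite (bigD1_seq j) ?iota_uniq //=.
rewrite lerDl big_seq_cond sumr_ge0 // => i; rewrite mem_index_iota => /andP[hi _].
by apply: hF; lia.
Qed.

(** Supplies a single constant, chosen before [t], for every quantity that depends only on the nodes
    and the weights [rho]. One plus the sum of all absolute values serves. Index 0 is included, so
    default values there are bounded as well. *)
Lemma bounded_family (R : realType) (N : nat) (f : nat -> nat -> nat -> R) :
  exists M, 1 <= M /\
    forall i j n, (i <= N)%N -> (j <= N)%N -> (n <= N)%N -> `|f i j n| <= M.
Proof.
exists (1 + \sum_(i < N.+1) \sum_(j < N.+1) \sum_(n < N.+1) `|f i j n|).
have s0 i j : 0 <= \sum_(n < N.+1) `|f i j n| by apply: sumr_ge0.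
have s1 i : 0 <= \sum_(j < N.+1) \sum_(n < N.+1) `|f i j n| by apply: sumr_ge0.
have s2 : 0 <= \sum_(i < N.+1) \sum_(j < N.+1) \sum_(n < N.+1) `|f i j n|.
  by apply: sumr_ge0.
split=> [|i j n hi hj hn]; first by rewrite lerDl.
rewrite -[leLHS]add0r; apply: lerD => //.
rewrite (bigD1 (Ordinal (hi : (i < N.+1)%N))) //=.
rewrite (bigD1 (Ordinal (hj : (j < N.+1)%N))) //=.
rewrite (bigD1 (Ordinal (hn : (n < N.+1)%N))) //=.
by rewrite -!addrA lerDl !addr_ge0 // sumr_ge0.
Qed.

Lemma size_monic_sub (R : nzRingType) (n : nat) (p q : {poly R}) :
  p \is monic -> q \is monic -> size p = n.+1 -> size q = n.+1 ->
  (size (p - q)%R <= n)%N.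
Proof.
move=> /monicP; rewrite /lead_coef => mp /monicP; rewrite /lead_coef => mq sp sq.
move: mp mq; rewrite sp sq /= => mp mq; apply/leq_sizeP => j.
rewrite leq_eqVlt coefB => /predU1P[<-|lt_nj]; first by rewrite mp mq subrr.
by rewrite !nth_default ?sp ?sq ?subrr.
Qed.

(** * Lagrange interpolation at the first nodes *)

Section Lagrange.
Variables (R : realType) (x : nat -> R).

Definition node_poly (n : nat) : {poly R} :=
  \prod_(i <- iota 1 n) ('X - (x i)%:P).

(** [rem] deletes one occurrence, which suffices because [iota 1 n] has no repetition. Products over
    sequences give roots and sizes directly. *)
Definition lagrange_num (n j : nat) : {poly R} :=
  \prod_(i <- rem j (iota 1 n)) ('X - (x i)%:P).

Definition lagrange_basis (n j : nat) : {poly R} :=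
  (lagrange_num n j).[x j]^-1 *: lagrange_num n j.

Lemma horner_prod_XsubC_eq0 (s : seq nat) (y : R) :
  ((\prod_(i <- s) ('X - (x i)%:P)).[y] == 0) = (y \in map x s).
Proof.
by rewrite -[LHS]/(root _ _) -(big_map x xpredT (fun z => 'X - z%:P)) root_prod_XsubC.
Qed.

Lemma node_poly_eq0 (n j : nat) : (1 <= j <= n)%N -> (node_poly n).[x j] = 0.
Proof.
move=> hj; apply/eqP; rewrite horner_prod_XsubC_eq0 map_f // mem_iota; lia.
Qed.

Lemma size_lagrange_basis (n j : nat) :
  (1 <= j <= n)%N -> (size (lagrange_basis n j) <= n)%N.
Proof.
move=> hj; apply: leq_trans (size_scale_leq _ _) _.
by rewrite size_prod_XsubC size_rem ?size_iota ?mem_iota; lia.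
Qed.

Variable N : nat.
Hypothesis x_inj :
  forall i j, (1 <= i <= N)%N -> (1 <= j <= N)%N -> x i = x j -> i = j.

Lemma node_poly_neq0 (n : nat) : (n < N)%N -> (node_poly n).[x n.+1] != 0.
Proof.
move=> hn; rewrite horner_prod_XsubC_eq0; apply/mapP => -[i].
by rewrite mem_iota => hi /x_inj; lia.
Qed.

Lemma lagrange_basisE (n i j : nat) : (n <= N)%N ->
  (1 <= i <= n)%N -> (1 <= j <= n)%N ->
  (lagrange_basis n j).[x i] = (i == j)%:R.
Proof.
move=> hn hi hj; rewrite hornerZ; case: eqP => [->|/eqP nij].
  rewrite mulVf // horner_prod_XsubC_eq0; apply/mapP => -[k].
  rewrite mem_rem_uniq ?iota_uniq // !inE mem_iota => /andP[nkj hk] /x_inj.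
  by move=> e; move: nkj; rewrite e ?eqxx //; lia.
suff /eqP -> : (lagrange_num n j).[x i] == 0 by rewrite mulr0.
rewrite horner_prod_XsubC_eq0 map_f // mem_rem_uniq ?iota_uniq // !inE nij.
by rewrite mem_iota; lia.
Qed.

(** Both sides agree at [n] distinct nodes, and the leading terms cancel, so the difference has
    degree below [n] and must vanish. *)
Lemma monic_lagrange (n : nat) (P : {poly R}) : (n <= N)%N ->
  P \is monic -> size P = n.+1 ->
  P = node_poly n + \sum_(1 <= j < n.+1) P.[x j] *: lagrange_basis n j.
Proof.
move=> hn mP sP; apply/eqP; rewrite -subr_eq0 opprD addrA; apply/eqP.
have sN : size (node_poly n) = n.+1 by rewrite size_prod_XsubC size_iota.
have mN : node_poly n \is monic by rewrite monic_prod_XsubC.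
apply: (@roots_geq_poly_eq0 _ _ (map x (iota 1 n))).
- apply/allP => y /mapP[i + ->]; rewrite mem_iota => hi.
  rewrite /root !(hornerE, horner_sum) node_poly_eq0 ?subr0; last by lia.
  have hi' : i \in index_iota 1 n.+1 by rewrite mem_index_iota; lia.
  rewrite (bigD1_seq i) ?iota_uniq //=.
  rewrite hornerZ lagrange_basisE ?eqxx ?mulr1; try lia.
  rewrite big_seq_cond big1 ?addr0 ?subrr // => k.
  rewrite mem_index_iota => /andP[hk nki].
  by rewrite hornerZ lagrange_basisE 1?eq_sym ?(negbTE nki) ?mulr0 //; lia.
- rewrite map_inj_in_uniq ?iota_uniq // => i j; rewrite !mem_iota => hi hj.
  by apply: x_inj; lia.
rewrite size_map size_iota; apply: leq_trans (size_polyD _ _) _.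
rewrite geq_max size_polyN size_monic_sub //=.
apply: leq_trans (size_sum _ _ _) _; apply/bigmax_leqP_seq => j.
rewrite mem_index_iota => hj _; apply: leq_trans (size_scale_leq _ _) _.
by apply: size_lagrange_basis; lia.
Qed.
End Lagrange.

Arguments node_poly {R} x n.
Arguments lagrange_basis {R} x n j.

(* [lia] also preprocesses the order hypotheses over [R], which makes it very
   slow. *)
Ltac natlia :=
  repeat match goal with
  | H : is_true (Order.le _ _) |- _ => clear H
  | H : is_true (Order.lt _ _) |- _ => clear H
  end; lia.

(** * Orthogonal polynomials for weights decreasing up to a factor *)

Section WeightedOrthogonality.
Variables (R : realType) (N : nat) (x w : nat -> R) (M : R).

Definition weighted_ip (p q : {poly R}) : R :=
  \sum_(1 <= j < N.+1) w j * p.[x j] * q.[x j].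

Lemma weighted_ipC p q : weighted_ip p q = weighted_ip q p.
Proof. by apply: eq_bigr => j _; ring. Qed.

Lemma weighted_ipDl p q r :
  weighted_ip (p + q) r = weighted_ip p r + weighted_ip q r.
Proof. by rewrite -big_split; apply: eq_bigr => j _ /=; rewrite hornerD; ring. Qed.

Lemma weighted_ipZl c p r : weighted_ip (c *: p) r = c * weighted_ip p r.
Proof. by rewrite mulr_sumr; apply: eq_bigr => j _; rewrite hornerZ; ring. Qed.

Lemma weighted_ipXl p r : weighted_ip ('X * p) r = weighted_ip p ('X * r).
Proof. by apply: eq_bigr => j _; rewrite !hornerM hornerX; ring. Qed.

Lemma weighted_ip_pythagoras p q : weighted_ip p q = 0 ->
  weighted_ip (p + q) (p + q) = weighted_ip p p + weighted_ip q q.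
Proof.
move=> o; rewrite weighted_ipDl ![weighted_ip _ (p + q)]weighted_ipC.
by rewrite !weighted_ipDl [weighted_ip q p]weighted_ipC o addr0 add0r.
Qed.

Hypothesis N_gt0 : (0 < N)%N.
Hypothesis M_ge1 : 1 <= M.

Let M_ge0 : 0 <= M := le_trans ler01 M_ge1.
Let N_ge1 : 1 <= N%:R :> R.
Proof. by rewrite ler1n. Qed.
Let N_ge0 : 0 <= N%:R :> R := le_trans ler01 N_ge1.

(** This constant and the following ones depend on [N] and [M] only; this is what makes the
    estimates uniform in [t] later. *)
Definition norm_ubound : R := N%:R * M ^+ 3.

Lemma norm_ubound_ge1 : 1 <= norm_ubound.
Proof. by rewrite -[1]mulr1 ler_pM // exprn_ege1. Qed.

Definition value_bound : R := M + N%:R * (norm_ubound * M * M).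

Lemma value_bound_ge0 : 0 <= value_bound.
Proof.
have k0 := le_trans ler01 norm_ubound_ge1.
by rewrite addr_ge0 // !mulr_ge0.
Qed.

Definition decay_const : R := N%:R * (M * value_bound * M).

Lemma decay_const_ge0 : 0 <= decay_const.
Proof. by rewrite !mulr_ge0 // value_bound_ge0. Qed.

Definition norm_lconst : R := (M * (1 + N%:R * M)) ^+ 2 * M.

Lemma norm_lconst_ge1 : 1 <= norm_lconst.
Proof.
have h : 1 <= M * (1 + N%:R * M).
  by rewrite -[leLHS]mulr1 ler_pM // lerDl mulr_ge0.
by rewrite -[1]mulr1 ler_pM // exprn_ege1.
Qed.

(** [value_bound] accounts for the nodes after [n.+1], [decay_const] for those before it, and
    [norm_lconst] converts [w n.+1] into the squared norm. *)
Definition moment_const : R :=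
  N%:R * (M ^+ 2 * (value_bound ^+ 2 + decay_const ^+ 2)) * norm_lconst.

Hypothesis x_inj :
  forall i j, (1 <= i <= N)%N -> (1 <= j <= N)%N -> x i = x j -> i = j.
Hypothesis node_bound :
  forall n i, (n <= N)%N -> (i <= N)%N -> `|(node_poly x n).[x i]| <= M.
Hypothesis lagrange_bound : forall n j i, (n <= N)%N -> (j <= N)%N -> (i <= N)%N ->
  `|(lagrange_basis x n j).[x i]| <= M.
Hypothesis dist_bound : forall i j, (i <= N)%N -> (j <= N)%N -> `|x i - x j| <= M.
Hypothesis node_lbound : forall n, (n < N)%N -> 1 <= M * `|(node_poly x n).[x n.+1]|.
Hypothesis w_gt0 : forall j, (1 <= j <= N)%N -> 0 < w j.
Hypothesis w_mono : forall i j, (1 <= i <= j)%N -> (j <= N)%N -> w j <= M * w i.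

Variables (n : nat) (P : {poly R}).
Hypothesis n_lt : (n < N)%N.
Hypothesis P_monic : P \is monic.
Hypothesis P_size : size P = n.+1.
Hypothesis P_orth : forall q : {poly R}, (size q <= n)%N -> weighted_ip P q = 0.

Lemma term_le_norm j : (1 <= j <= N)%N -> w j * P.[x j] ^+ 2 <= weighted_ip P P.
Proof.
move=> hj; rewrite expr2 mulrA.
apply: (@term_le_sum _ _ (fun i => w i * P.[x i] * P.[x i])) => // i hi.
by rewrite -mulrA -expr2 mulr_ge0 ?sqr_ge0 // ltW // w_gt0.
Qed.

(* Extremality: the monic orthogonal polynomial has least norm, and the
   competitor [node_poly] vanishes at the [n] heaviest points. *)
Lemma norm_le : weighted_ip P P <= norm_ubound * w n.+1.
Proof.
set Q := node_poly x n.
have sQ : size Q = n.+1 by rewrite size_prod_XsubC size_iota.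
have mQ : Q \is monic by rewrite monic_prod_XsubC.
(* The leading terms of [Q] and [P] cancel, so Pythagoras applies to [Q = P + (Q - P)]. *)
have o : weighted_ip P (Q - P) = 0 by apply/P_orth/size_monic_sub.
have QQ : weighted_ip Q Q = weighted_ip P P + weighted_ip (Q - P) (Q - P).
  by rewrite -weighted_ip_pythagoras // addrC subrK.
apply: (@le_trans _ _ (weighted_ip Q Q)).
  rewrite QQ lerDl /weighted_ip big_nat; apply: sumr_ge0 => j hj.
  by rewrite -mulrA -expr2 mulr_ge0 ?sqr_ge0 // ltW // w_gt0 //; natlia.
rewrite /norm_ubound -mulrA; apply: sum_le_const => j hj.
have wn : 0 < w n.+1 by apply: w_gt0.
have [le_jn|lt_nj] := leqP j n.
  rewrite node_poly_eq0 ?mulr0; last by natlia.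
  by rewrite mulr_ge0 ?exprn_ge0 // ltW.
rewrite -mulrA -expr2 -real_normK ?num_real //.
(* One factor [M] pays for the weight, two for the squared value of [Q]. *)
have -> : M ^+ 3 * w n.+1 = (M * w n.+1) * M ^+ 2 by ring.
apply: ler_pM; rewrite ?sqr_ge0 //; first by rewrite ltW // w_gt0.
  by apply: w_mono; natlia.
by rewrite ler_pXn2r ?nnegrE // node_bound //; natlia.
Qed.

(** A single term of the squared norm is at most a constant times [w n.+1], hence times [w j]; the
    weight [w j] then cancels. *)
Lemma poly_at_first j : (1 <= j <= n)%N -> `|P.[x j]| <= norm_ubound * M.
Proof.
move=> hj; have k1 := norm_ubound_ge1.
have kM : 1 <= norm_ubound * M by rewrite -[1]mulr1 ler_pM.
have wj : 0 < w j by apply: w_gt0; natlia.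
have h2 : P.[x j] ^+ 2 <= norm_ubound * M.
  rewrite -(ler_pM2l wj); apply: le_trans (term_le_norm _ _) _; first by natlia.
  apply: le_trans norm_le _.
  have -> : w j * (norm_ubound * M) = norm_ubound * (M * w j) by ring.
  by rewrite ler_pM2l ?(lt_le_trans ltr01) // w_mono; natlia.
(* The constant is at least 1, so it dominates its own square root. *)
rewrite -(@ler_pXn2r _ 2) ?nnegrE ?(le_trans ler01 kM) //.
rewrite real_normK ?num_real //; apply: le_trans h2 _.
by rewrite expr2 ler_peMr // (le_trans ler01 kM).
Qed.

(** At light nodes the norm gives no uniform control; interpolation carries the bound over from the
    first [n] nodes. *)
Lemma poly_at_le i : (1 <= i <= N)%N -> `|P.[x i]| <= value_bound.
Proof.
move=> hi; have k0 := le_trans ler01 norm_ubound_ge1.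
rewrite (@monic_lagrange _ x N x_inj n P (ltnW n_lt) P_monic P_size) hornerD.
apply: le_trans (ler_normD _ _) _; apply: lerD; first by apply: node_bound; natlia.
rewrite horner_sum; apply: le_trans (ler_norm_sum _ _ _) _.
apply: (@le_trans _ _ (n%:R * (norm_ubound * M * M))).
  apply: sum_le_const => j hj; rewrite hornerZ normrM.
  by apply: ler_pM => //; [apply: poly_at_first | apply: lagrange_bound; natlia].
by apply: ler_wpM2r; rewrite ?mulr_ge0 // ler_nat ltnW.
Qed.

(* Orthogonality to [lagrange_basis n j] leaves only the [j]-th term and the
   terms of the light points [i > n]; this gains a full factor over the
   estimate [term_le_norm]. *)
Lemma poly_decay j : (1 <= j <= n)%N -> w j * `|P.[x j]| <= decay_const * w n.+1.
Proof.
move=> hj; have wj : 0 < w j by apply: w_gt0; natlia.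
have wn : 0 < w n.+1 by apply: w_gt0.
have b0 := value_bound_ge0.
have := P_orth _ (size_lagrange_basis _ x n j hj).
have hj' : j \in index_iota 1 N.+1 by rewrite mem_index_iota; natlia.
rewrite /weighted_ip (bigD1_seq j) ?iota_uniq //=.
rewrite (@lagrange_basisE _ x N) ?eqxx ?mulr1; try natlia; last exact: x_inj.
move/eqP; rewrite addr_eq0 => /eqP e.
(* [big_mkcond] turns the excluded index [j] into a zero term, so that all [N] terms can be bounded
   alike. *)
rewrite -{1}(gtr0_norm wj) -normrM e normrN big_mkcond.
apply: le_trans (ler_norm_sum _ _ _) _.
rewrite /decay_const -mulrA; apply: sum_le_const => i hi.
have r0 : 0 <= M * value_bound * M * w n.+1 by rewrite !mulr_ge0 // ltW.
case: eqP => [_|/eqP nij] /=; first by rewrite normr0.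
have [le_in|lt_ni] := leqP i n.
  rewrite (@lagrange_basisE _ x N) ?(negbTE nij) ?mulr0 ?normr0 //; try natlia.
have -> : M * value_bound * M * w n.+1 = M * w n.+1 * value_bound * M by ring.
rewrite !normrM; apply: ler_pM; rewrite ?mulr_ge0 //; last by apply: lagrange_bound; natlia.
apply: ler_pM => //; last exact: poly_at_le.
by rewrite gtr0_norm ?w_gt0 // w_mono; natlia.
Qed.

(** If the norm were small compared with [w n.+1], then [P] would be small at the first [n.+1]
    nodes. By interpolation [node_poly x n] would be small at [x n.+1], against [node_lbound]. *)
Lemma norm_ge : w n.+1 <= norm_lconst * weighted_ip P P.
Proof.
have wn : 0 < w n.+1 by apply: w_gt0.
set h := weighted_ip P P.
have h0 : 0 <= h.
  apply: le_trans (term_le_norm n.+1 _); last by natlia.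
  by rewrite mulr_ge0 ?sqr_ge0 // ltW.
(* Bounds [P] at the first [n.+1] nodes: there [w j] times the squared value is at most [h], and
   [w n.+1 <= M * w j]. *)
pose s := Num.sqrt (M * h / w n.+1).
have s0 : 0 <= s by rewrite sqrtr_ge0.
have ss : s ^+ 2 = M * h / w n.+1 by rewrite sqr_sqrtr // divr_ge0 ?mulr_ge0 // ltW.
have Ps j : (1 <= j <= n.+1)%N -> `|P.[x j]| <= s.
  move=> hj; rewrite -(@ler_pXn2r _ 2) ?nnegrE // ss real_normK ?num_real //.
  rewrite ler_pdivlMr //; apply: le_trans (_ : P.[x j] ^+ 2 * (M * w j) <= _).
    by rewrite ler_wpM2l ?sqr_ge0 // w_mono; natlia.
  have -> : P.[x j] ^+ 2 * (M * w j) = M * (w j * P.[x j] ^+ 2) by ring.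
  by rewrite ler_wpM2l // term_le_norm; natlia.
have nodes : `|(node_poly x n).[x n.+1]| <= (1 + N%:R * M) * s.
  have e := @monic_lagrange _ x N x_inj n P (ltnW n_lt) P_monic P_size.
  have -> : node_poly x n = P - \sum_(1 <= j < n.+1) P.[x j] *: lagrange_basis x n j.
    by rewrite {1}e addrK.
  rewrite hornerD hornerN horner_sum mulrDl mul1r.
  apply: le_trans (ler_normB _ _) _; apply: lerD; first by apply: Ps; natlia.
  apply: le_trans (ler_norm_sum _ _ _) _; rewrite -mulrA.
  apply: (@le_trans _ _ (n%:R * (M * s))).
    apply: sum_le_const => j hj; rewrite hornerZ normrM mulrC.
    by apply: ler_pM => //; [apply: lagrange_bound; natlia | apply: Ps; natlia].
  by apply: ler_wpM2r; rewrite ?mulr_ge0 // ler_nat ltnW.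
have key : 1 <= M * (1 + N%:R * M) * s.
  by apply: le_trans (node_lbound n n_lt) _; rewrite -mulrA ler_wpM2l.
have : 1 <= (M * (1 + N%:R * M) * s) ^+ 2 by rewrite exprn_ege1.
rewrite exprMn ss !mulrA ler_pdivlMr // mul1r.
by rewrite /norm_lconst -!mulrA.
Qed.

(** [U] and [V] bound the ratios of neighbouring weights. The implications allow for a missing
    neighbour at either end, where 0 may be taken. *)
Lemma moment_le (U V : R) : 0 <= U -> 0 <= V ->
  ((n.+2 <= N)%N -> w n.+2 <= U * w n.+1) ->
  ((1 <= n)%N -> w n.+1 <= V * w n) ->
  `|weighted_ip ('X * P) P - x n.+1 * weighted_ip P P|
    <= moment_const * (U + V) * weighted_ip P P.
Proof.
move=> U0 V0 hU hV; have wn : 0 < w n.+1 by apply: w_gt0.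
have b0 := value_bound_ge0; have d0 := decay_const_ge0.
pose B := value_bound; pose S := decay_const.
have -> : weighted_ip ('X * P) P - x n.+1 * weighted_ip P P =
    \sum_(1 <= j < N.+1) (x j - x n.+1) * (w j * P.[x j] ^+ 2).
  rewrite mulr_sumr -sumrB; apply: eq_bigr => j _.
  by rewrite hornerM hornerX; ring.
have q0 : 0 <= M ^+ 2 * (B ^+ 2 + S ^+ 2) by rewrite mulr_ge0 ?addr_ge0 ?sqr_ge0.
apply: (@le_trans _ _ (N%:R * (M ^+ 2 * (B ^+ 2 + S ^+ 2) * (U + V) * w n.+1))).
  apply: le_trans (ler_norm_sum _ _ _) _; apply: sum_le_const => j hj.
  have wj : 0 < w j by apply: w_gt0.
  have m0 : 0 <= M ^+ 2 by apply: sqr_ge0.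
  have B0 : 0 <= B ^+ 2 by apply: sqr_ge0.
  have S0 : 0 <= S ^+ 2 by apply: sqr_ge0.
  rewrite normrM [X in _ * X]ger0_norm; last by rewrite mulr_ge0 ?sqr_ge0 // ltW.
  have [lt_jn|lt_nj|->] := ltngtP j n.+1.
  - have hj1 : (1 <= j <= n)%N by natlia.
    have dj := poly_decay j hj1.
    (* [poly_decay] is used twice on the squared value: here with [w j] cancelled through
       [w n.+1 <= V * w n <= V * M * w j], and below with [w j] kept. *)
    have sV : `|P.[x j]| <= S * V * M.
      rewrite -(ler_pM2l wj); apply: le_trans dj _.
      have -> : w j * (S * V * M) = S * (V * (M * w j)) by ring.
      apply: ler_wpM2l => //; apply: le_trans (hV _) _; first by natlia.
      by rewrite ler_wpM2l // w_mono; natlia.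
    rewrite -real_normK ?num_real // expr2 [w j * _]mulrA.
    apply: (@le_trans _ _ (M * (S * w n.+1 * (S * V * M)))).
      have wP0 : 0 <= w j * `|P.[x j]| by rewrite mulr_ge0 // ltW.
      apply: ler_pM => //; first by rewrite mulr_ge0.
        by apply: dist_bound; natlia.
      exact: ler_pM.
    have -> : M * (S * w n.+1 * (S * V * M)) = M ^+ 2 * (S ^+ 2 * V) * w n.+1 by ring.
    rewrite ler_pM2r // -mulrA ler_wpM2l //.
    by apply: ler_pM; rewrite ?lerDl ?lerDr.
  (* Beyond [n.+1] the smallness comes from the weight alone. *)
  - have wj2 : w j <= M * (U * w n.+1).
      apply: (@le_trans _ _ (M * w n.+2)); first by apply: w_mono; natlia.
      by rewrite ler_wpM2l // hU; natlia.
    apply: (@le_trans _ _ (M * (M * (U * w n.+1) * B ^+ 2))).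
      apply: ler_pM => //; first by rewrite mulr_ge0 ?sqr_ge0 // ltW.
        by apply: dist_bound; natlia.
      apply: ler_pM; rewrite ?sqr_ge0 ?(ltW wj) //.
      by rewrite -real_normK ?num_real // ler_pXn2r ?nnegrE // poly_at_le.
    have -> : M * (M * (U * w n.+1) * B ^+ 2) = M ^+ 2 * (B ^+ 2 * U) * w n.+1 by ring.
    rewrite ler_pM2r // -mulrA ler_wpM2l //.
    by apply: ler_pM; rewrite ?lerDl ?lerDr.
  - by rewrite subrr normr0 mul0r !mulr_ge0 ?addr_ge0 // ltW.
rewrite /moment_const -/B -/S.
set c := M ^+ 2 * _.
have -> : N%:R * c * norm_lconst * (U + V) * weighted_ip P P =
  N%:R * (c * (U + V) * (norm_lconst * weighted_ip P P)) by ring.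
rewrite ler_wpM2l // ler_wpM2l ?norm_ge // mulr_ge0 // addr_ge0 //.
Qed.

End WeightedOrthogonality.

Arguments weighted_ip {R} N x w p q.

(** * Ratios of tilted weights *)

Lemma tilt_weight_gt0 (R : realType) (N : nat) (x rho : nat -> R) (t : R) (j : nat) :
  (forall j, (1 <= j <= N)%N -> 0 < rho j) -> (1 <= j <= N)%N ->
  0 < tilt_weight N x rho t j.
Proof.
move=> hrho hj.
have h i : (1 <= i <= N)%N -> 0 < rho i * expR (2 * t * x i).
  by move=> hi; rewrite mulr_gt0 ?expR_gt0 ?hrho.
apply: divr_gt0; first exact: h.
apply: lt_le_trans (h j hj) _.
by apply: (@term_le_sum _ _ (fun i => rho i * expR (2 * t * x i))) => // i /h/ltW.
Qed.

(** The normalizing sum cancels in the quotient. Neighbouring indices give the decay rates; [i < j]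
    with [0 <= t] gives monotonicity up to [M]. *)
Lemma tilt_weight_ratio (R : realType) (N : nat) (x rho : nat -> R) (t M : R)
  (i j : nat) : (forall j, (1 <= j <= N)%N -> 0 < rho j) ->
  (1 <= i <= N)%N -> (1 <= j <= N)%N -> `|rho j / rho i| <= M ->
  tilt_weight N x rho t j <=
    M * expR (2 * t * (x j - x i)) * tilt_weight N x rho t i.
Proof.
move=> hrho hi hj hM; have wi := tilt_weight_gt0 _ _ x _ t i hrho hi.
have ri : rho i != 0 by rewrite gt_eqF ?hrho.
have -> : tilt_weight N x rho t j = rho j / rho i * expR (2 * t * (x j - x i))
    * tilt_weight N x rho t i.
  rewrite /tilt_weight; set Z := \sum_(_ <= _ < _) _.
  have -> : expR (2 * t * x j) = expR (2 * t * (x j - x i)) * expR (2 * t * x i).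
    by rewrite -expRD; congr expR; ring.
  by rewrite -[rho j in LHS](divfK ri); ring.
rewrite ler_pM2r // ler_pM2r ?expR_gt0 //.
by apply: le_trans (ler_norm _) hM.
Qed.

(** * Estimates for the Jacobi parameters *)

Theorem theorem2p6 (R : realType) (N : nat) (x rho : nat -> R)
  (a b : R -> nat -> R)
  (hN : (2 <= N)%N)
  (hx : forall j, (1 <= j < N)%N -> x j.+1 < x j)
  (hrho : forall j, (1 <= j <= N)%N -> 0 < rho j)
  (hsum : \sum_(1 <= j < N.+1) rho j = 1)
  (hab : forall t, 0 <= t -> jacobi_params N x rho t (a t) (b t)) :
  exists C3 C4 : R, forall t, 0 <= t ->
    (forall j, (1 <= j <= N)%N ->
       `|b t j - x j| <=
         C3 * ((if (j < N)%N then expR (2 * t * (x j.+1 - x j)) else 0)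
             + (if (1 < j)%N then expR (2 * t * (x j - x j.-1)) else 0))) /\
    (forall j, (1 <= j <= N.-1)%N ->
       `|a t j| <=
         C4 * ((if (j.+2 <= N)%N then expR (t * (x j.+2 - x j.+1)) else 0)
             + expR (t * (x j.+1 - x j))
             + (if (1 < j)%N then expR (t * (x j - x j.-1)) else 0))).
Proof.
have x_lt i j : (1 <= i < j)%N -> (j <= N)%N -> x j < x i.
  elim: j => [|j IH] hij hj; first by natlia.
  have [<-|nij] := eqVneq i j; first by apply: hx; natlia.
  by apply: lt_trans (IH _ _); [apply: hx|..]; natlia.
have x_inj i j : (1 <= i <= N)%N -> (1 <= j <= N)%N -> x i = x j -> i = j.
  move=> hi hj e; have [l|l|//] := ltngtP i j.
  - by have := x_lt i j; rewrite e ltxx => /(_ _ _)/idP; natlia.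
  - by have := x_lt j i; rewrite e ltxx => /(_ _ _)/idP; natlia.
(* The five summands are nonnegative, so one [M] bounds each of them. The inverse gives the lower
   bound on [node_poly] at the next node. *)
have [M [M1 hM]] := bounded_family R N (fun i j n =>
  `|(node_poly x n).[x i]| + `|(lagrange_basis x n j).[x i]| + `|x i - x j|
  + `|(node_poly x n).[x n.+1]|^-1 + `|rho j / rho i|).
have M0 : 0 <= M by apply: le_trans M1.
have {hM} [M_node M_lag M_dist M_nodeV M_rho] :
  [/\ forall n i, (n <= N)%N -> (i <= N)%N -> `|(node_poly x n).[x i]| <= M,
      forall n j i, (n <= N)%N -> (j <= N)%N -> (i <= N)%N ->
        `|(lagrange_basis x n j).[x i]| <= M,
      forall i j, (i <= N)%N -> (j <= N)%N -> `|x i - x j| <= M,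
      forall n, (n <= N)%N -> `|(node_poly x n).[x n.+1]|^-1 <= M &
      forall i j, (i <= N)%N -> (j <= N)%N -> `|rho j / rho i| <= M].
  have V0 n : 0 <= `|(node_poly x n).[x n.+1]|^-1 by rewrite invr_ge0.
  have h i j n hi hj hn := le_trans (ler_norm _) (hM i j n hi hj hn).
  split=> [n i hn hi|n j i hn hj hi|i j hi hj|n hn|i j hi hj].
  - apply: le_trans (h i i n hi hi hn); rewrite -!addrA lerDl.
    by rewrite !addr_ge0.
  - apply: le_trans (h i j n hi hj hn); rewrite -!addrA addrCA lerDl.
    by rewrite !addr_ge0.
  - apply: le_trans (h i j i hi hj hi); rewrite addrAC -addrA addrAC lerDr.
    by rewrite !addr_ge0.
  - apply: le_trans (h n n n hn hn hn); rewrite addrAC lerDr.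
    by rewrite !addr_ge0.
  - apply: le_trans (h i j i hi hj hi); rewrite lerDr.
    by rewrite !addr_ge0.
have M_nodelb n : (n < N)%N -> 1 <= M * `|(node_poly x n).[x n.+1]|.
  move=> hn; have y0 : 0 < `|(node_poly x n).[x n.+1]|.
    by rewrite normr_gt0 (@node_poly_neq0 _ x N).
  by rewrite -ler_pdivrMr // div1r M_nodeV // ltnW.
pose C := moment_const R N M; pose K := norm_ubound R N M; pose D := norm_lconst R N M.
have K1 : 1 <= K by apply: norm_ubound_ge1 => //; natlia.
have D1 : 1 <= D by apply: norm_lconst_ge1 => //; natlia.
have N0 : (0 < N)%N by natlia.
(* In both constants the factor [M] comes from the weight ratio. [K] and [D] bound the numerator and
   the denominator of the norm quotient that equals the squared [a]. *)
exists (C * M), (K * D * M) => t t0.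
have [a_gt0 [P [hP rec]]] := hab t t0.
pose w := tilt_weight N x rho t.
have w_gt0 j : (1 <= j <= N)%N -> 0 < w j by apply: tilt_weight_gt0.
have w_ratio i j : (1 <= i <= N)%N -> (1 <= j <= N)%N ->
    w j <= M * expR (2 * t * (x j - x i)) * w i.
  by move=> hi hj; apply: tilt_weight_ratio => //; apply: M_rho; natlia.
have w_mono i j : (1 <= i <= j)%N -> (j <= N)%N -> w j <= M * w i.
  move=> hij hj; have wi : 0 < w i by apply: w_gt0; natlia.
  have [->|nij] := eqVneq i j; first by rewrite ler_peMl // ltW // w_gt0 //; natlia.
  apply: le_trans (w_ratio i j _ _) _; try natlia.
  rewrite ler_pM2r // ler_piMr // -[leRHS]expR0 ler_expR.
  apply: mulr_ge0_le0; first by rewrite mulr_ge0.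
  by rewrite subr_le0 ltW // x_lt; natlia.
have orth n (q : {poly R}) : (n <= N)%N -> (size q <= n)%N -> weighted_ip N x w (P n) q = 0.
  by move=> hn; have [_ _] := hP n hn; apply.
have monicP n : (n <= N)%N -> P n \is monic by move=> /hP[].
have sizeP n : (n <= N)%N -> size (P n) = n.+1 by move=> /hP[].
have orthP m n : (m < n <= N)%N -> weighted_ip N x w (P n) (P m) = 0.
  by move=> hmn; apply: orth; rewrite ?sizeP; natlia.
have norm_lb n : (n < N)%N -> w n.+1 <= D * weighted_ip N x w (P n) (P n).
  move=> hn; apply: (@norm_ge R N x w M) => //; [exact/monicP/ltnW|exact/sizeP/ltnW].
have norm_ub n : (n < N)%N -> weighted_ip N x w (P n) (P n) <= K * w n.+1.
  move=> hn; apply: (@norm_le R N x w M) => //; [exact/monicP/ltnW|exact/sizeP/ltnW|].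
  by move=> q; apply: orth; rewrite ltnW.
have norm_gt0 n : (n < N)%N -> 0 < weighted_ip N x w (P n) (P n).
  move=> hn; have := lt_le_trans (w_gt0 n.+1 hn) (norm_lb n hn).
  by rewrite pmulr_rgt0 // (lt_le_trans ltr01).
(* At [n = 0] the previous polynomial is 0, so the arbitrary value [a t 0] never enters. *)
have prev_orth n : (n <= N)%N -> weighted_ip N x w (P n) (prevP P n) = 0.
  case: n => [|n] hn /=; last by apply: orth; rewrite ?sizeP // ltnW.
  by apply: orth; rewrite ?size_poly0.
split=> [[//|n] /= hn|[//|n] /= hn].
- have hn' : (n < N)%N by natlia.
  (* With [j = n.+1], pairing the recurrence with [P n] isolates [b t j]. *)
  have bE : weighted_ip N x w ('X * P n) (P n)
      = b t n.+1 * weighted_ip N x w (P n) (P n).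
    rewrite rec // !weighted_ipDl !weighted_ipZl orth ?sizeP ?(ltnW hn') //.
    rewrite [weighted_ip _ _ _ (prevP P n) _]weighted_ipC prev_orth; last exact: ltnW.
    by rewrite mulr0 addr0 add0r.
  set U := if _ then _ else _; set V := if _ then _ else _.
  have U0 : 0 <= U by rewrite /U; case: ifP; rewrite ?expR_ge0.
  have V0 : 0 <= V by rewrite /V; case: ifP; rewrite ?expR_ge0.
  have h : `|weighted_ip N x w ('X * P n) (P n)
        - x n.+1 * weighted_ip N x w (P n) (P n)|
      <= C * (M * U + M * V) * weighted_ip N x w (P n) (P n).
    apply: (@moment_le R N x w M) => //; rewrite ?mulr_ge0 //.
    + exact/monicP/ltnW.
    + exact/sizeP/ltnW.
    + by move=> q; apply: orth; rewrite ltnW.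
    + by move=> h; rewrite /U h; apply: w_ratio; natlia.
    + by move=> h; rewrite /V ltnS h; apply: w_ratio; natlia.
  move: h; rewrite bE -mulrBl normrM (gtr0_norm (norm_gt0 n hn')).
  by rewrite ler_pM2r ?norm_gt0 // -mulrDr mulrA.
have hn1 : (n < N)%N by natlia.
have hn2 : (n.+1 < N)%N by natlia.
set e := expR (t * (x n.+2 - x n.+1)).
have e0 : 0 <= e by apply: expR_ge0.
(* Evaluate the pairing of ['X * P n.+1] with [P n] twice: by the recurrence for [P n.+1], and by
   moving ['X] across and using the recurrence for [P n]. *)
have aE : weighted_ip N x w (P n.+1) (P n.+1)
    = a t n.+1 ^+ 2 * weighted_ip N x w (P n) (P n).
  have e1 : weighted_ip N x w ('X * P n.+1) (P n)
      = a t n.+1 ^+ 2 * weighted_ip N x w (P n) (P n).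
    rewrite rec //= !weighted_ipDl !weighted_ipZl.
    by rewrite (orthP n n.+2) ?(orthP n n.+1) ?mulr0 ?add0r //; natlia.
  rewrite -e1 weighted_ipXl rec // [RHS]weighted_ipC !weighted_ipDl !weighted_ipZl.
  rewrite [weighted_ip _ _ _ (P n) _]weighted_ipC.
  rewrite [weighted_ip _ _ _ (prevP P n) _]weighted_ipC.
  rewrite (orthP n n.+1) ?(orth n.+1 (prevP P n)) ?mulr0 ?addr0 //; try natlia.
  by case: (n) hn1 => [|m] hm /=; rewrite ?size_poly0 ?sizeP //; natlia.
have sq : a t n.+1 ^+ 2 <= K * D * M * e ^+ 2.
  rewrite -(ler_pM2r (norm_gt0 n hn1)) -aE.
  apply: le_trans (norm_ub n.+1 hn2) _.
  have -> : K * D * M * e ^+ 2 * weighted_ip N x w (P n) (P n) =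
    K * (M * e ^+ 2 * (D * weighted_ip N x w (P n) (P n))) by ring.
  rewrite ler_pM2l ?(lt_le_trans ltr01) //.
  apply: (@le_trans _ _ (M * e ^+ 2 * w n.+1)).
    have -> : e ^+ 2 = expR (2 * t * (x n.+2 - x n.+1)).
      by rewrite expr2 -expRD; congr expR; ring.
    by apply: w_ratio; natlia.
  by rewrite ler_wpM2l ?norm_lb // mulr_ge0 ?sqr_ge0.
have C1 : 1 <= K * D * M.
  by rewrite -[1]mulr1 ler_pM // -[1]mulr1 ler_pM.
have C0 : 0 <= K * D * M by apply: le_trans C1.
(* Since [K * D * M] is at least 1, it may replace its square root. The middle exponential alone
   suffices; the outer terms are nonnegative. *)
apply: (@le_trans _ _ (K * D * M * e)).
  have Ce0 : 0 <= K * D * M * e by apply: mulr_ge0.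
  rewrite -(@ler_pXn2r _ 2) ?nnegrE // real_normK ?num_real //.
  apply: le_trans sq _; rewrite exprMn ler_wpM2r ?sqr_ge0 //.
  by rewrite expr2 ler_peMr.
rewrite ler_wpM2l // -/e.
have U0 : 0 <= if (n.+3 <= N)%N then expR (t * (x n.+3 - x n.+2)) else 0.
  by case: ifP; rewrite ?expR_ge0.
have V0 : 0 <= if (1 < n.+1)%N then expR (t * (x n.+1 - x n)) else 0.
  by case: ifP; rewrite ?expR_ge0.
by rewrite -addrA addrCA lerDl addr_ge0.
Qed.
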